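(* Let $G$ be a connected graph belonging to $\mathbf{W}_2$, with $n=n(G)$ and $\alpha=\alpha(G)\ge2$. Suppose that $n\ge3\alpha$. Then the independence polynomial $I(G;x)$ is log-concave whenever at least one of the following two conditions holds: (1) $3\alpha\le n\le 2\alpha+2\sqrt{2\alpha+2}$ and $\dfrac{\alpha^2}{4(\alpha+1)}\le2$; (2) $2\alpha+2\sqrt{2\alpha+2}<n\le\dfrac{2(\alpha^2+1)+(\alpha-1)^2}{\alpha-1}$ and $\dfrac{\alpha(\alpha-1)}{\alpha+1}\le2$.
   Context: All graphs are finite, undirected and simple. $V(G)$ is the vertex set, $n(G)=|V(G)|$, and $\alpha(G)$ is the maximum cardinality of an independent set of $G$. A maximum independent set is an independent set of cardinality $\alpha(G)$. The empty set is an independent set. For an integer $p\ge1$, a graph $G$ belongs to $\mathbf{W}_p$ if $n(G)\ge p$ and, for every $p$ pairwise disjoint independent sets $A_1,\ldots,A_p$ of $G$ (possibly empty), there exist $p$ pairwise disjoint maximum independent sets $S_1,\ldots,S_p$ of $G$ such that $A_i\subseteq S_i$ for every $i$. The independence polynomial of $G$ is $I(G;x)=\sum_{k=0}^{\alpha(G)}s_kx^k$, where $s_k$ is the number of independent sets of $G$ of cardinality $k$. It is log-concave if $s_k^2\ge s_{k-1}s_{k+1}$ for all $1\le k\le\alpha(G)-1$. *)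

(* Defs.v *)
From HB Require Import structures.
From mathcomp Require Import all_boot all_order all_algebra.

Set Implicit Arguments.
Unset Strict Implicit.
Unset Printing Implicit Defensive.

Import Order.TTheory GRing.Theory Num.Theory.

Local Open Scope ring_scope.

(* A finite simple graph is a symmetric irreflexive relation e on a finType. *)

Section Graphs.

Variables (T : finType) (e : rel T).

Definition connected_graph : Prop := forall x y : T, connect e x y.

Definition independent (S : {set T}) : bool :=
  [forall x in S, forall y in S, ~~ e x y].

Definition alpha : nat := (\max_(S : {set T} | independent S) #|S|)%N.

Definition max_independent (S : {set T}) : bool :=
  independent S && (#|S| == alpha).

Definition pairwise_disjoint (p : nat) (A : 'I_p -> {set T}) : Prop :=
  forall i j : 'I_p, i != j -> [disjoint A i & A j].

(* The class W_p, for p >= 1. *)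
Definition in_W (p : nat) : Prop :=
  (p <= #|T|)%N /\
  forall A : 'I_p -> {set T},
    (forall i, independent (A i)) -> pairwise_disjoint A ->
    exists S : 'I_p -> {set T},
      [/\ forall i, max_independent (S i),
          pairwise_disjoint S
        & forall i, A i \subset S i].

Definition num_independent (k : nat) : nat :=
  #|[set S : {set T} | independent S & #|S| == k]|.

Definition indep_poly : {poly int} :=
  \poly_(k < alpha.+1) (num_independent k)%:R.

End Graphs.

(* For p = indep_poly e, the degree (size p).-1 is alpha e: see
   size_indep_poly. *)
Definition log_concave (p : {poly int}) : Prop :=
  forall k : nat, (1 <= k <= (size p).-1 - 1)%N ->
    p`_(k - 1) * p`_(k + 1) <= p`_k ^+ 2.

Lemma size_indep_poly (T : finType) (e : rel T) :
  size (indep_poly e) = (alpha e).+1.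
Proof.
apply: size_poly_eq.
have ind0 : independent e set0.
  by apply/forall_inP => x; rewrite inE.
have [S indS ->] : {S | independent e S & alpha e = #|S|}.
  by apply: eq_bigmax_cond; apply/card_gt0P; exists set0.
rewrite pnatr_eq0 -lt0n; apply/card_gt0P; exists S.
by rewrite inE indS eqxx.
Qed.

(* Main.v *)
Require Import Defs.
From mathcomp Require Import all_boot all_order all_algebra.
From mathcomp Require Import zify lra.
Import Order.TTheory GRing.Theory Num.Theory.
Local Open Scope ring_scope.

(** The product (k+1) s_(k+1) is the sum, over the independent sets A of size k,
    of the number of vertices outside the closed neighbourhood N[A]
    ([sum_card_link]). So bounds on |V \ N[A]| become bounds on the ratios
    s_(k+1) / s_k, and log-concavity follows as soon as the upper bound for
    s_(k+1) / s_k is at most the lower bound for s_k / s_(k-1).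

    Lower bound. A graph of W_2 has an exchange property: every independent A
    and every vertex x outside A admit a maximum independent set that contains
    A and avoids x. Applied to a partial independent set, the property passes
    from U to U \ N[A] ([exchangeable_link]), and it forbids isolated vertices.
    Peeling A one vertex at a time, each vertex keeps a private neighbour, so
    |N(A)| >= |A| ([card_le_nbh]); in particular |V| >= 2 alpha. For the graph
    V \ N[A], of independence number alpha - |A|, this reads
    |V \ N[A]| >= 2 (alpha - |A|).

    Upper bound. The point is that |N(A)| >= 2 |A| for every independent A, so
    that |V \ N[A]| <= n - 3 |A|. The structural theorem behind it is
    [exchangeable_tight_part]: in a graph with the exchange property, any
    independent A with |N(A)| < 2 |A| contains a nonempty A0 such that N[A0] is
    a union of connected components and has exactly 3 |A0| - 1 vertices.
    In a connected graph N[A0] is then everything, so n = 3 |A0| - 1 < 3 alpha,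
    which the hypothesis n >= 3 alpha excludes.

    The two bounds reduce log-concavity at k to the quadratic inequality
    k n <= k^2 + 2 alpha k + 2 alpha + 2. In the first case the discriminant of
    the quadratic in k is nonpositive; in the second case alpha is 2 or 3, and
    the bound on n is the inequality at k = alpha - 1, which for alpha = 3
    implies the one at k = 1. *)

Section Exchange.

Local Open Scope nat_scope.
Set Implicit Arguments.
Unset Strict Implicit.

Variables (T : finType) (e : rel T).
Hypotheses (e_sym : symmetric e) (e_irr : irreflexive e).
Implicit Types (A B C D F S U V : {set T}) (x y z : T).

Definition nbh A := [set y | [exists x in A, e x y]].

Definition clnbh A := A :|: nbh A.

(** Subgraphs are all induced on subsets U of a fixed vertex set: the recursion
    only ever deletes closed neighbourhoods, and this avoids subtypes. *)
Definition link U A := U :\: clnbh A.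

Definition alpha_in U := \max_(S : {set T} | independent e S && (S \subset U)) #|S|.

(** This one-vertex form of the W_2 property is preferred to the one with two
    disjoint sets because it visibly survives the deletion of N[A]. *)
Definition exchangeable U := forall A x,
  independent e A -> A \subset U -> x \in U -> x \notin A ->
  exists S, [/\ independent e S, A \subset S, S \subset U, x \notin S
              & #|S| = alpha_in U].

(** N[A] is a union of connected components of the subgraph induced on U. *)
Definition closed_nbh U A := forall y z,
  y \in U -> z \in U -> y \in clnbh A -> e y z -> z \in clnbh A.

(** * Neighbourhoods and independent sets *)

Lemma nbhP A y : reflect (exists2 x, x \in A & e x y) (y \in nbh A).
Proof. by rewrite inE; apply: exists_inP. Qed.

Lemma indepP A : reflect {in A &, forall x y, ~~ e x y} (independent e A).
Proof.
apply: (iffP forall_inP) => [h x y xA yA|h x xA].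
  by move/forall_inP: (h x xA); apply.
by apply/forall_inP => y yA; apply: h.
Qed.

Lemma indepS A B : A \subset B -> independent e B -> independent e A.
Proof.
move=> /subsetP sAB /indepP iB; apply/indepP => x y xA yA.
by apply: iB; apply: sAB.
Qed.

Lemma indep0 : independent e set0.
Proof. by apply/indepP => x y; rewrite inE. Qed.

Lemma indep1 x : independent e [set x].
Proof. by apply/indepP => y z; rewrite !inE => /eqP-> /eqP->; rewrite e_irr. Qed.

Lemma nbhU A B : nbh (A :|: B) = nbh A :|: nbh B.
Proof.
apply/setP => y; rewrite in_setU; apply/nbhP/orP.
  by case=> x /setUP[] xA exy; [left|right]; apply/nbhP; exists x.
by case=> /nbhP[x xA exy]; exists x => //; apply/setUP; [left|right].
Qed.

Lemma nbhS A B : A \subset B -> nbh A \subset nbh B.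
Proof.
move=> /subsetP sAB; apply/subsetP => y /nbhP[x /sAB xB exy].
by apply/nbhP; exists x.
Qed.

Lemma indep_nbh A x : independent e A -> x \in A -> x \notin nbh A.
Proof.
by move=> /indepP iA xA; apply/nbhP => -[y yA]; apply/negP; apply: iA.
Qed.

Lemma indepU A B : independent e A -> independent e B ->
  (forall y, y \in B -> y \notin nbh A) -> independent e (A :|: B).
Proof.
move=> /indepP iA /indepP iB h; apply/indepP => x y /setUP[xA|xB] /setUP[yA|yB].
- exact: iA.
- by apply/negP => exy; case/nbhP: (h _ yB); exists x.
- by rewrite e_sym; apply/negP => exy; case/nbhP: (h _ xB); exists y.
- exact: iB.
Qed.

Lemma in_link U A y : (y \in link U A) = [&& y \notin A, y \notin nbh A & y \in U].
Proof. by rewrite /link /clnbh in_setD in_setU negb_or andbA. Qed.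

Lemma link_sub U A : link U A \subset U.
Proof. exact: subsetDl. Qed.

Lemma indepU_link U A B : independent e A -> independent e B ->
  B \subset link U A -> independent e (A :|: B).
Proof.
move=> iA iB /subsetP sB; apply: indepU => // y /sB.
by rewrite in_link => /and3P[].
Qed.

Lemma link_disjoint U A B : B \subset link U A -> [disjoint A & B].
Proof.
move=> /subsetP sB; rewrite disjoint_subset; apply/subsetP => y yA.
by rewrite inE; apply/negP => /sB; rewrite in_link yA.
Qed.

Lemma setD_link U A S : independent e S -> A \subset S -> S \subset U ->
  S :\: A \subset link U A.
Proof.
move=> iS sAS /subsetP sSU; apply/subsetP => y /setDP[yS yA].
rewrite in_link yA sSU // andbT /=.
by apply: contra (indep_nbh iS yS) => /(subsetP (nbhS sAS)).
Qed.

(** * The exchange property and deletion of closed neighbourhoods *)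

Lemma alpha_in_max U A : independent e A -> A \subset U -> #|A| <= alpha_in U.
Proof.
move=> iA sAU.
by apply: (@leq_bigmax_cond _ _ (fun S : {set T} => #|S|)); rewrite iA.
Qed.

Lemma alpha_in_witness U :
  exists S, [/\ independent e S, S \subset U & #|S| = alpha_in U].
Proof.
have [S /andP[iS sS] ->] : {S | independent e S && (S \subset U) & alpha_in U = #|S|}.
  by apply: eq_bigmax_cond; apply/card_gt0P; exists set0; rewrite unfold_in indep0 sub0set.
by exists S.
Qed.

(** Exchangeable graphs are well-covered: a vertex to avoid is at hand unless A
    fills U. *)
Lemma extend_max U A : exchangeable U -> independent e A -> A \subset U ->
  exists S, [/\ independent e S, A \subset S, S \subset U & #|S| = alpha_in U].
Proof.
move=> EU iA sAU; have [sUA|/subsetPn[x xU xA]] := boolP (U \subset A).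
  have [S [iS sS cS]] := alpha_in_witness U.
  exists A; split=> //; apply/eqP; rewrite eqn_leq alpha_in_max //= -cS.
  by rewrite subset_leq_card // (subset_trans sS).
by have [S [? ? ? _ ?]] := EU A x iA sAU xU xA; exists S.
Qed.

Lemma card_setU_link U A B : B \subset link U A -> #|A :|: B| = #|A| + #|B|.
Proof. by move=> sB; apply/eqP; rewrite (leq_card_setU A B) (link_disjoint sB). Qed.

Lemma alpha_link U B : exchangeable U -> independent e B -> B \subset U ->
  alpha_in (link U B) + #|B| = alpha_in U.
Proof.
move=> EU iB sB; apply/eqP; rewrite eqn_leq; apply/andP; split.
  have [S [iS sS <-]] := alpha_in_witness (link U B).
  rewrite addnC -(card_setU_link sS) alpha_in_max ?(indepU_link _ _ sS) //.
  by rewrite subUset sB (subset_trans sS) // link_sub.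
have [S [iS sBS sSU <-]] := extend_max EU iB sB.
rewrite -(cardsID B S) addnC leq_add ?subset_leq_card ?subsetIr //.
apply: alpha_in_max; first exact: indepS (subsetDl _ _) iS.
exact: setD_link.
Qed.

(** Exchange B :|: A against x in U and discard B. *)
Lemma exchangeable_link U B : exchangeable U -> independent e B -> B \subset U ->
  exchangeable (link U B).
Proof.
move=> EU iB sB A x iA sA xU xA.
have sAU : A \subset U by rewrite (subset_trans sA) // link_sub.
have [||||S [iS sS sSU xS cS]] := EU (B :|: A) x.
- exact: indepU_link sA.
- by rewrite subUset sB.
- by move: xU; rewrite in_link => /and3P[].
- by move: xU; rewrite in_link in_setU negb_or xA => /andP[->].
have /andP[sBS sAS] : (B \subset S) && (A \subset S) by rewrite -subUset.
exists (S :\: B); split.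
- exact: indepS (subsetDl _ _) iS.
- rewrite subsetD sAS disjoint_sym; exact: link_disjoint sA.
- exact: setD_link.
- by rewrite inE negb_and xS orbT.
- by rewrite cardsD (setIidPr sBS) cS -(alpha_link EU iB sB) addnK.
Qed.

(** Makes |N(A)| additive when A is processed in two stages, the second one in
    the graph left by the first. *)
Lemma card_nbhU U A B : independent e A -> B \subset link U A ->
  #|U :&: nbh (A :|: B)| = #|U :&: nbh A| + #|link U A :&: nbh B|.
Proof.
move=> iA sB; rewrite nbhU -(cardsID (nbh A)) -setIA (setIidPr (subsetUl _ _)).
congr (_ + #|pred_of_set _|).
apply/setP => y; rewrite in_setD !in_setI in_setU in_link.
case yA: (y \in nbh A) => //=; first by rewrite andbF.
case yB: (y \in nbh B); rewrite ?andbF ?andbT //=.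
case yAA: (y \in A) => //=.
case/nbhP: yB => b bB eby; move/subsetP: sB => /(_ b bB).
rewrite in_link => /and3P[_ /nbhP[]]; exists y => //; by rewrite e_sym.
Qed.

(** A maximum independent set that avoids an isolated x could be enlarged by x. *)
Lemma exchangeable_nbr U x : exchangeable U -> x \in U -> exists2 y, y \in U & e x y.
Proof.
move=> EU xU; have [||||S [iS _ sSU xS cS]] := EU set0 x => //.
- exact: indep0.
- exact: sub0set.
- by rewrite inE.
have [/exists_inP[y yU exy]|noy] := boolP [exists y in U, e x y]; first by exists y.
have: #|x |: S| <= #|S|.
  rewrite cS alpha_in_max ?subUset ?sub1set ?xU //.
  apply: indepU => // [|y yS]; first exact: indep1.
  apply: contra noy => /nbhP[z]; rewrite inE => /eqP-> exy.
  by apply/exists_inP; exists y => //; apply: (subsetP sSU).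
by rewrite cardsU1 xS ltnn.
Qed.

(** Once N[A :\ x] is deleted, x is still a vertex of an exchangeable graph,
    hence has a neighbour that no other vertex of A sees. *)
Lemma card_le_nbh U A : exchangeable U -> independent e A -> A \subset U ->
  #|A| <= #|U :&: nbh A|.
Proof.
have [k] := ubnP #|A|; elim: k A => // k IH A leA EU iA sA.
have [->|[x xA]] := set_0Vmem A; first by rewrite cards0.
have iB : independent e (A :\ x) by apply: indepS iA; apply: subsetDl.
have sB : A :\ x \subset U by apply: subset_trans sA; apply: subsetDl.
have sx : [set x] \subset link U (A :\ x).
  have := setD_link iA (subsetDl A [set x]) sA.
  by rewrite setDDr setDv set0U (setIidPr _) // sub1set.
have [y yU exy] := exchangeable_nbr (exchangeable_link EU iB sB)
  (subsetP sx x (set11 x)).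
have -> : A = (A :\ x) :|: [set x] by rewrite setUC setD1K.
rewrite (card_nbhU iB sx) (card_setU_link sx) leq_add ?IH //.
  by move: leA; rewrite (cardsD1 x A) xA; lia.
rewrite cards1 card_gt0; apply/set0Pn; exists y; rewrite in_setI yU.
by apply/nbhP; exists x; rewrite ?set11.
Qed.

(** * Independent sets with few neighbours *)

(** Here |N[A0]| = 3 |A0| - 1, as for K_2 and the 5-cycle with A0 maximum. *)
Definition has_tight_part U A := exists A0 : {set T},
  [/\ A0 != set0, A0 \subset A, closed_nbh U A0
    & #|U :&: nbh A0| = (2 * #|A0|).-1].

(** When N[A] is a union of components, nothing outside it sees it; this and
    the next two lemmas let a component found after deleting N[A] count as one of U. *)
Lemma setI_clnbh U A : closed_nbh U A -> A \subset U ->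
  forall B, B \subset link U A -> U :&: clnbh B \subset link U A.
Proof.
move=> cA /subsetP sA B /subsetP sB; apply/subsetP => y /setIP[yU /setUP[/sB //|/nbhP[b /sB]]].
rewrite !in_setD yU andbT => /andP[bA bU] eby.
by apply: contra bA => yA; apply: (cA y b); rewrite // e_sym.
Qed.

Lemma closed_nbh_link U A B : closed_nbh U A -> A \subset U ->
  B \subset link U A -> closed_nbh (link U A) B -> closed_nbh U B.
Proof.
move=> cA sA sB cB y z yU zU yB eyz.
have yL : y \in link U A.
  by apply: (subsetP (setI_clnbh cA sA sB)); rewrite inE yU.
apply: (cB y z) => //; move: yL; rewrite !in_setD zU yU !andbT.
by apply: contra => zA; apply: (cA z y); rewrite // e_sym.
Qed.

Lemma link_closed_nbhI U A B : closed_nbh U A -> A \subset U ->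
  B \subset link U A -> U :&: nbh B = link U A :&: nbh B.
Proof.
move=> cA sA sB; apply/eqP; rewrite eqEsubset; apply/andP; split.
  rewrite subsetI subsetIr andbT (subset_trans _ (setI_clnbh cA sA sB)) //.
  by rewrite setIS // subsetUr.
by rewrite setSI // link_sub.
Qed.

(** A pigeonhole over the tight components. Each one removed from A lowers the
    quantity 2 |A| - |N(A)| by one, so if A is maximum there are at least
    2 |A| - |N(A)| > |A| - |D| of them, and D, which lacks only |A| - |D|
    vertices to be maximum, must reach the independence number of some
    component. The existence of tight parts is a hypothesis because the lemma
    serves inside the induction that proves it. *)
Lemma tight_part_meets_half U A D :
  (forall V B, V \subset U -> B \subset A ->
     exchangeable V -> independent e B -> B \subset V ->
     #|V :&: nbh B| < 2 * #|B| -> has_tight_part V B) ->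
  exchangeable U -> independent e A -> A \subset U -> #|A| = alpha_in U ->
  independent e D -> D \subset U -> #|U :&: nbh A| < #|A| + #|D| ->
  exists A0 : {set T},
  [/\ A0 \subset A, closed_nbh U A0, #|U :&: nbh A0| < 2 * #|A0|
    & #|A0| <= #|D :&: clnbh A0|].
Proof.
have [k] := ubnP #|A|; elim: k U A D => // k IH U A D leA tight EU iA sA cA iD sD ltN.
have leDA : #|D| <= #|A| by rewrite cA alpha_in_max.
have [||||||A0 [A0n sA0 clA0 cA0]] := tight U A => //.
  by apply: leq_trans ltN _; lia.
have A0pos : 0 < #|A0| by rewrite card_gt0.
have [leD|ltD] := leqP #|A0| #|D :&: clnbh A0|.
  by exists A0; split => //; lia.
have sA0U : A0 \subset U by apply: subset_trans sA.
have iA0 : independent e A0 by apply: indepS iA.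
have sA1 := setD_link iA sA0 sA.
have iA1 : independent e (A :\: A0) by apply: indepS iA; apply: subsetDl.
have cA1 : #|A :\: A0| + #|A0| = #|A| by rewrite addnC -{1}(setIidPr sA0) cardsID.
have cD := cardsID (clnbh A0) D.
have cN : #|U :&: nbh A| = #|U :&: nbh A0| + #|link U A0 :&: nbh (A :\: A0)|.
  rewrite -(card_nbhU iA0 sA1); congr #|pred_of_set (_ :&: nbh _)|.
  by rewrite -{1}[A](setID A A0) (setIidPr sA0).
have [|||||||||A1 [sA1' clA1 cN1 leA1]] := IH (link U A0) (A :\: A0) (D :\: clnbh A0) => //.
- by move: leA cA1 A0pos; clear; lia.
- move=> V B sV sB; apply: tight; first exact: subset_trans sV (link_sub _ _).
  exact: subset_trans sB (subsetDl _ _).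
- exact: exchangeable_link.
- by move: (alpha_link EU iA0 sA0U) cA1 cA; clear; lia.
- by apply: indepS iD; apply: subsetDl.
- exact: setSD.
- by move: ltN cN cA1 cD ltD cA0 A0pos; clear; lia.
have sA1L : A1 \subset link U A0 by apply: subset_trans sA1' _.
exists A1; split.
- by apply: subset_trans sA1' _; apply: subsetDl.
- exact: closed_nbh_link clA1.
- by rewrite (link_closed_nbhI clA0).
- by apply: leq_trans leA1 _; rewrite subset_leq_card // setSI // subsetDl.
Qed.

Lemma has_tight_partS U A B : B \subset A -> has_tight_part U B -> has_tight_part U A.
Proof.
by move=> sB [A0 [? sA0 ? ?]]; exists A0; split=> //; apply: subset_trans sB.
Qed.

(** The private neighbour of a vertex x of A adds one to |N(A :\ x)|, so a
    minimal deficient set is deficient by exactly one. *)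
Lemma min_deficient_card_nbh U A : exchangeable U -> independent e A -> A \subset U ->
  A != set0 -> (forall B, B \proper A -> 2 * #|B| <= #|U :&: nbh B|) ->
  2 * #|A| <= #|U :&: nbh A|.+1.
Proof.
move=> EU iA sA /set0Pn[x xA] hB.
have pB : A :\ x \proper A by rewrite properD1.
have iB : independent e (A :\ x) := indepS (proper_sub pB) iA.
have sB : A :\ x \subset U := subset_trans (proper_sub pB) sA.
have sx : [set x] \subset link U (A :\ x).
  have := setD_link iA (subsetDl A [set x]) sA.
  by rewrite setDDr setDv set0U (setIidPr _) // sub1set.
have defA : A = (A :\ x) :|: [set x] by rewrite setUC setD1K.
have := card_le_nbh (exchangeable_link EU iB sB) (indep1 x) sx.
have := card_nbhU iB sx; have := card_setU_link sx; rewrite -defA cards1.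
by move: (hB _ pB); clear; lia.
Qed.

(** By induction on |U| + |A| one may assume that A is minimal with
    |N(A)| < 2 |A|, and then N[A] itself is claimed to be a union of components.
    Otherwise some vertex y0 of N(A) is adjacent to a vertex z0 of H = U \ N[A].

    A vertex y of N(A) that sees H is adjacent to all of A: if the set B of
    the vertices of A that it misses is nonempty, then induction in U \ N[B] puts
    y in a union of components inside N[A], so y cannot see H.

    Let Q be the set of vertices of U adjacent to all of A, and S a maximum
    independent set of H through z0. In U' = U \ N[S], the set A is maximum independent and has fewer neighbours than
    in U, so by induction U' has a proper tight component. As a vertex of Q
    would link all the components, Q is disjoint from U', which thus falls into
    at least 1 + |Q| tight components.

    Let F be a maximum independent set of Q. A maximum independent set of
    U \ N[F] has alpha(U) - |F| vertices, at most alpha(U) - |A| of them in H,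
    so at least |A| - |F| in U'. By the pigeonhole it contains |A0| vertices of
    some tight component N[A0]. They lie outside A, so among the 2 |A0| - 1
    vertices of N(A0); their neighbours in U \ N[F] lie there too, and there are
    at least |A0| of these by the exchange property: a contradiction. *)
Theorem exchangeable_tight_part U A : exchangeable U -> independent e A -> A \subset U ->
  #|U :&: nbh A| < 2 * #|A| -> has_tight_part U A.
Proof.
have [k] := ubnP (#|U| + #|A|); elim: k U A => // k IH U A lek EU iA sA ltA.
have [/existsP[B /andP[pB ltB]]|] :=
    boolP [exists B : {set T}, (B \proper A) && (#|U :&: nbh B| < 2 * #|B|)].
  have sB := proper_sub pB.
  apply: (has_tight_partS sB); apply: IH => //.
  - by move: (proper_card pB) lek; clear; lia.
  - exact: indepS iA.
  - exact: subset_trans sA.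
move=> /existsPn hB.
have {}hB B : B \proper A -> 2 * #|B| <= #|U :&: nbh B|.
  by move=> pB; have := hB B; rewrite pB /= -leqNgt.
have A_neq0 : A != set0 by rewrite -card_gt0; move: ltA; clear; lia.
have cardN : #|U :&: nbh A|.+1 = 2 * #|A|.
  by apply/eqP; rewrite eqn_leq ltA min_deficient_card_nbh.
exists A; split=> //; last by rewrite -cardN.
move=> y0 z0 y0U z0U y0A ey0z0; apply: contraT => z0A.
pose H := link U A.
have z0H : z0 \in H by rewrite in_setD z0A.
have {}y0A : y0 \in nbh A.
  case/setUP: y0A => // y0A; case/negP: z0A; apply/setUP; right.
  by apply/nbhP; exists y0.
pose Q := [set y in U | [forall x in A, e x y]].
have QP y : reflect (y \in U /\ forall x, x \in A -> e x y) (y \in Q).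
  by rewrite inE; apply: (iffP andP) => -[yU /forall_inP].
(* Minimality of A gives |N(B)| >= 2 |B|, so the deficit passes to A :\: B. *)
have adjH y z : y \in U -> y \in nbh A -> z \in H -> e y z -> y \in Q.
  move=> yU yA; rewrite in_link => /and3P[zA zNA zU] eyz.
  pose B := [set x in A | ~~ e x y].
  have sBA : B \subset A by apply/subsetP => x; rewrite inE => /andP[].
  have [B0|B_neq0] := eqVneq B set0.
    apply/QP; split=> // x xA; apply: contraT => nxy.
    by move/setP/(_ x): B0; rewrite !inE xA nxy.
  have pB : B \proper A.
    rewrite properEneq sBA andbT; apply/eqP => BA.
    by case/nbhP: yA => x; rewrite -BA inE => /andP[_ /negP].
  have iB := indepS sBA iA; have sBU := subset_trans sBA sA.
  have sAB := setD_link iA sBA sA.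
  have cAB : #|B| + #|A :\: B| = #|A| by rewrite -{1}(setIidPr sBA) cardsID.
  have cN : #|U :&: nbh A| = #|U :&: nbh B| + #|link U B :&: nbh (A :\: B)|.
    rewrite -(card_nbhU iB sAB); congr #|pred_of_set (_ :&: nbh _)|.
    by rewrite -{1}[A](setID A B) (setIidPr sBA).
  have [|||||A0 [/set0Pn[x xA0] sA0 clA0 _]] := IH (link U B) (A :\: B).
  - have := subset_leq_card (link_sub U B).
    by move: lek cAB B_neq0; rewrite -card_gt0; clear; lia.
  - exact: exchangeable_link.
  - exact: indepS (subsetDl _ _) iA.
  - by [].
  - by move: (hB _ pB) cN cAB ltA; clear; lia.
  have exy : e x y.
    by have /setDP[xA] := subsetP sA0 _ xA0; rewrite inE xA negbK.
  have sA0A : A0 \subset A := subset_trans sA0 (subsetDl _ _).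
  exfalso; have := clA0 y z; rewrite !in_link zU yU !andbT.
  have -> : y \notin B.
    by apply/negP => yB; case/negP: (indep_nbh iA (subsetP sBA y yB)).
  have -> : y \notin nbh B.
    by apply/nbhP => -[w]; rewrite inE => /andP[_ /negP].
  have -> : z \notin B by apply: contra zA; apply: (subsetP sBA).
  have -> : z \notin nbh B by apply: contra zNA; apply: (subsetP (nbhS sBA)).
  move=> /(_ isT isT) h; have /setUP[zA0|zA0] : z \in clnbh A0.
  - apply: h eyz; apply/setUP; right; apply/nbhP; by exists x.
  - by case/negP: zA; apply: (subsetP sA0A).
  - by case/negP: zNA; apply: (subsetP (nbhS sA0A)).
have y0Q : y0 \in Q by apply: adjH ey0z0.
have EH : exchangeable H by apply: exchangeable_link.
have sHU : H \subset U := link_sub U A.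
have [|S [iS sz0S sSH cS]] := extend_max EH (indep1 z0); first by rewrite sub1set.
have z0S : z0 \in S by rewrite -sub1set.
have sSU := subset_trans sSH sHU.
pose U' := link U S.
have EU' : exchangeable U' by apply: exchangeable_link.
have sAU' : A \subset U'.
  apply/subsetP => x xA; rewrite in_link (subsetP sA) // andbT.
  apply/andP; split.
    by apply/negP => /(subsetP sSH); rewrite in_link xA.
  apply/nbhP => -[w /(subsetP sSH)]; rewrite in_link => /and3P[_ /nbhP h _] ewx.
  by case: h; exists x; rewrite // e_sym.
(* S is maximum in link U A, so A is maximum in link U S. *)
have cAU' : #|A| = alpha_in U'.
  have := alpha_link EU iA sA; have := alpha_link EU iS sSU.
  by rewrite -/U' -/H cS; clear; lia.
have ltU' : #|U'| < #|U|.
  apply: proper_card; apply/properP; split; first exact: link_sub.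
  by exists z0 => //; rewrite in_link z0S.
have nbhU'_sub : U' :&: nbh A \subset U :&: nbh A by rewrite setSI ?link_sub.
have ltU'N : #|U' :&: nbh A| < #|U :&: nbh A|.
  apply: proper_card; apply/properP; split=> //.
  exists y0; first by rewrite in_setI y0U.
  rewrite in_setI in_link; apply/negP => /andP[/and3P[_ /nbhP[]]].
  by exists z0; rewrite // e_sym.
have QU' q : q \in Q -> q \notin U'.
  move=> /QP[qU Aq]; apply/negP => qU'.
  have [|||||A0 [/set0Pn[x xA0] sA0 clA0 cA0]] := IH U' A => //.
  - by move: lek ltU'; clear; lia.
  - by exact: leq_trans ltU'N (ltnW ltA).
  have defA0 : A0 = A.
    apply/eqP; rewrite eqEsubset sA0; apply/subsetP => w wA.
    have /setUP[//|] : w \in clnbh A0.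
      apply: (clA0 q w) => //; first exact: (subsetP sAU').
        by apply/setUP; right; apply/nbhP; exists x => //; apply/Aq/(subsetP sA0).
      by rewrite e_sym; apply: Aq.
    by move/(subsetP (nbhS sA0)); apply: contraLR => _; apply: indep_nbh.
  by move: cA0 ltU'N cardN; rewrite defA0; clear; lia.
have sQ : Q \subset (U :&: nbh A) :\: (U' :&: nbh A).
  apply/subsetP => q qQ; rewrite in_setD !in_setI (negPf (QU' q qQ)) /=.
  have [-> Aq] := QP _ qQ; have /set0Pn[x xA] := A_neq0.
  by apply/nbhP; exists x => //; apply: Aq.
have [F [iF sFQ cF]] := alpha_in_witness Q.
have F_neq0 : F != set0.
  rewrite -card_gt0 cF -(cards1 y0) alpha_in_max ?indep1 // sub1set //.
have sFU : F \subset U by apply: subset_trans sFQ _; apply/subsetP => q /QP[].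
have EF : exchangeable (link U F) by apply: exchangeable_link.
(* Deleting N[F] removes A, as F is nonempty, and Q, as F is maximal in Q. *)
have linkF w : w \in link U F -> w \notin H ->
    [/\ w \in nbh A, w \notin A, w \in U' & {in H, forall h, ~~ e w h}].
  rewrite in_link => /and3P[wF wNF wU] wH.
  have wA : w \notin A.
    apply: contra wNF => wA; have /set0Pn[q qF] := F_neq0.
    apply/nbhP; exists q => //; rewrite e_sym.
    by have /QP[_] := subsetP sFQ q qF; apply.
  have wNA : w \in nbh A by move: wH; rewrite in_link wA wU andbT negbK.
  have wQ : w \notin Q.
    apply/negP => wQ.
    have : #|F :|: [set w]| <= #|F|.
      rewrite cF alpha_in_max ?subUset ?sFQ ?sub1set //.
      by apply: indepU => // [|v]; [exact: indep1|rewrite inE => /eqP->].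
    by rewrite setUC cardsU1 wF ltnn.
  have wHadj : {in H, forall h, ~~ e w h}.
    by move=> h hH; apply: contra wQ; apply: adjH.
  split=> //; rewrite in_link wU andbT; apply/andP; split.
    by apply: contra wH; apply: (subsetP sSH).
  apply/nbhP => -[s sS]; rewrite e_sym; apply/negP/wHadj; exact: (subsetP sSH).
have [D' [iD' sD' cD']] := alpha_in_witness (link U F).
pose D := D' :\: H.
have iD : independent e D := indepS (subsetDl _ _) iD'.
have DP d : d \in D -> d \in link U F /\ d \notin H.
  by case/setDP => dD' dH; split=> //; apply: (subsetP sD').
have sDU' : D \subset U' by apply/subsetP => d /DP[dF dH]; have [] := linkF d dF dH.
have cardD : #|A| <= #|D| + #|F|.
  have := cardsID H D'; have := alpha_link EU iF sFU; have := alpha_link EU iA sA.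
  have : #|D' :&: H| <= alpha_in H.
    by rewrite alpha_in_max ?subsetIr // (indepS (subsetIl _ _) iD').
  by rewrite cD' -/H -/D; clear; lia.
have cardN' : #|U' :&: nbh A| + #|F| <= #|U :&: nbh A|.
  rewrite -(cardsID (U' :&: nbh A) (U :&: nbh A)) (setIidPr nbhU'_sub) leq_add2l.
  by rewrite subset_leq_card // (subset_trans sFQ).
have [||A0 [sA0 clA0 ltA0 leA0]] := @tight_part_meets_half U' A D _ EU' iA sAU' cAU' iD sDU'.
- move=> V B sV sB EV iB sBV ltB; apply: IH => //.
  by move: (subset_leq_card sV) (subset_leq_card sB) lek ltU'; clear; lia.
- by move: cardN' cardD cardN; clear; lia.
(* The set D0 and its neighbours in U \ N[F] are disjoint and both lie in
   N(A0), which has fewer than 2 |A0| vertices in U'. *)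
pose D0 := D :&: clnbh A0.
have iD0 : independent e D0 := indepS (subsetIl _ _) iD.
have sD0F : D0 \subset link U F.
  by apply/subsetP => d /setIP[/DP[]].
have := card_le_nbh EF iD0 sD0F.
have : #|D0 :|: link U F :&: nbh D0| <= #|U' :&: nbh A0|.
  apply: subset_leq_card; apply/subsetP => w.
  have nA0 v : v \notin A -> v \in clnbh A0 -> v \in nbh A0.
    by move=> vA /setUP[/(subsetP sA0)|//]; rewrite (negPf vA).
  case/setUP=> [/setIP[/DP[wF wH] wA0]|/setIP[wF /nbhP[d /setIP[dD dA0] edw]]].
    by have [_ wA wU' _] := linkF w wF wH; rewrite in_setI wU' nA0.
  have [dF dH] := DP d dD; have [_ dA dU' dadj] := linkF d dF dH.
  have wH : w \notin H by apply/negP => /dadj; rewrite edw.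
  have [_ wA wU' _] := linkF w wF wH.
  by rewrite in_setI wU' nA0 //; apply: (clA0 d w).
have -> : #|D0 :|: link U F :&: nbh D0| = #|D0| + #|link U F :&: nbh D0|.
  apply/eqP; rewrite (leq_card_setU _ _) disjoint_subset.
  apply/subsetP => d dD0; rewrite inE; apply/negP => /setIP[_].
  exact/negP/indep_nbh.
by move: ltA0 leA0; rewrite -/D0; clear; lia.
Qed.

(** * Consequences for W_2 graphs *)

Lemma double_alpha_in_le U : exchangeable U -> 2 * alpha_in U <= #|U|.
Proof.
move=> EU; have [S [iS sS <-]] := alpha_in_witness U.
rewrite mul2n -addnn -(cardsID S U) (setIidPr sS) leq_add2l.
apply: leq_trans (card_le_nbh EU iS sS) _; apply: subset_leq_card.
apply/subsetP => y /setIP[yU yS]; rewrite inE yU andbT.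
by apply: contraL yS; apply: indep_nbh.
Qed.

Lemma alpha_in_setT : alpha_in [set: T] = alpha e.
Proof. by apply: eq_bigl => S; rewrite subsetT andbT. Qed.

(** Extend the disjoint sets A and [set x]; the first extension avoids x. *)
Lemma in_W2_exchangeable : in_W e 2 -> exchangeable [set: T].
Proof.
move=> [_ W2] A x iA _ _ xA.
have [||S [maxS disS sAS]] := W2 (fun i : 'I_2 => if i == ord0 then A else [set x]).
- by move=> i; case: ifP => // _; apply: indep1.
- have dxA : [disjoint A & [set x]].
    by rewrite disjoint_sym (@eq_disjoint1 _ x) // => y; rewrite inE.
  move=> i j; case: (unliftP ord0 i) => [i'|] ->; case: (unliftP ord0 j) => [j'|] ->.
  + by rewrite !ord1 eqxx.
  + by rewrite disjoint_sym.
  + by [].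
  + by rewrite eqxx.
have /andP[iS /eqP cS] := maxS ord0; exists (S ord0); split=> //.
- exact: (sAS ord0).
- have := disS ord0 (lift ord0 ord0) isT; apply: contraTN => xS.
  apply/negP => /disjointFr /(_ xS); rewrite (subsetP (sAS (lift ord0 ord0))) //.
  exact: set11.
- by rewrite cS alpha_in_setT.
Qed.

Lemma connected_closed_nbh A x : connected_graph e -> closed_nbh [set: T] A ->
  x \in A -> clnbh A = [set: T].
Proof.
move=> con clA xA; apply/setP => y; rewrite in_setT.
have cl : closed e (clnbh A).
  by apply: intro_closed => [z w|z w ezw zA]; [exact: sym_connect_sym|exact: (clA z w)].
by rewrite -(closed_connect cl (con x y)) in_setU xA.
Qed.

Lemma double_card_le_nbh A : connected_graph e -> exchangeable [set: T] ->
  3 * alpha e <= #|T| -> independent e A -> 2 * #|A| <= #|nbh A|.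
Proof.
move=> con ET le3 iA; rewrite leqNgt; apply/negP => ltA.
have [|A0 [/set0Pn[x xA0] sA0 clA0]] :=
  exchangeable_tight_part ET iA (subsetT A); first by rewrite setTI.
rewrite setTI => cA0; have := connected_closed_nbh con clA0 xA0.
move/(congr1 (fun B : {set T} => #|B|)); rewrite cardsT => cT.
have := leq_card_setU A0 (nbh A0); rewrite -/(clnbh A0) cT cA0 => -[leT _].
have leA0 : #|A0| <= alpha e.
  by rewrite -alpha_in_setT alpha_in_max ?subsetT // (indepS sA0).
have : 0 < #|A0| by apply/card_gt0P; exists x.
by move: leT leA0 le3; clear; lia.
Qed.

Lemma card_linkT A : independent e A -> #|link [set: T] A| + (#|A| + #|nbh A|) = #|T|.
Proof.
move=> iA; rewrite -cardsT -(cardsID (clnbh A) [set: T]) setTI addnC; congr (_ + _).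
apply/esym/eqP; rewrite (leq_card_setU _ _) disjoint_subset.
by apply/subsetP => d dA; rewrite inE; apply: indep_nbh.
Qed.

(** Both sides count the pairs of an independent set of size k + 1 and a vertex
    in it. *)
Lemma sum_card_link k :
  \sum_(A : {set T} | independent e A && (#|A| == k)) #|link [set: T] A|
  = k.+1 * num_independent e k.+1.
Proof.
have -> : k.+1 * num_independent e k.+1 =
    \sum_(B : {set T} | independent e B && (#|B| == k.+1)) #|B|.
  rewrite mulnC -sum_nat_const; apply: eq_big => [B|B]; first by rewrite inE.
  by rewrite inE => /andP[_ /eqP].
under eq_bigr => A _ do rewrite -sum1_card.
under [RHS]eq_bigr => A _ do rewrite -sum1_card.
rewrite (exchange_big_dep predT) //= [RHS](exchange_big_dep predT) //=.
apply: eq_bigr => x _.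
rewrite [RHS](reindex_onto (fun A => x |: A) (fun B => B :\ x)) /=; last first.
  by move=> B /andP[_ xB]; rewrite setD1K.
apply: eq_bigl => A; rewrite setU11 andbT in_link in_setT andbT.
have [xA|xA] /= := boolP (x \in A).
  rewrite andbF; apply/esym/negbTE; apply/negP => /andP[_ /eqP/setP/(_ x)].
  by rewrite !inE eqxx xA.
rewrite setU1K // eqxx andbT cardsU1 xA add1n eqSS andbAC; congr (_ && _).
apply/andP/idP => [[iA xNA]|iA].
  rewrite setUC; apply: indepU => // [|y]; first exact: indep1.
  by rewrite inE => /eqP->.
split; first by apply: indepS iA; apply: subsetUr.
apply/negP => xNA; case/negP: (indep_nbh iA (setU11 x A)).
by apply: (subsetP (nbhS _)) xNA; apply: subsetUr.
Qed.

Lemma num_independent_up k : exchangeable [set: T] ->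
  2 * (alpha e - k) * num_independent e k <= k.+1 * num_independent e k.+1.
Proof.
move=> ET; rewrite -sum_card_link mulnC -sum_nat_const.
rewrite (eq_bigl (fun A : {set T} => independent e A && (#|A| == k))); last first.
  by move=> A; rewrite inE.
apply: leq_sum => A /andP[iA /eqP <-].
apply: leq_trans (double_alpha_in_le (exchangeable_link ET iA (subsetT A))).
by rewrite -alpha_in_setT -(alpha_link ET iA (subsetT A)) addnK.
Qed.

Lemma num_independent_down k : connected_graph e -> exchangeable [set: T] ->
  3 * alpha e <= #|T| ->
  k.+1 * num_independent e k.+1 <= (#|T| - 3 * k) * num_independent e k.
Proof.
move=> con ET le3; rewrite -sum_card_link mulnC -sum_nat_const.
rewrite [leqRHS](eq_bigl (fun A : {set T} => independent e A && (#|A| == k))); last first.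
  by move=> A; rewrite inE.
apply: leq_sum => A /andP[iA /eqP <-].
have := double_card_le_nbh con ET le3 iA; have := card_linkT iA.
by clear; lia.
Qed.

End Exchange.

(** * Arithmetic of the ratios *)

(** The hypothesis that is quadratic in k says that the upper bound
    (n - 3k) / (k + 1) for s2 / s1 is at most the lower bound
    2 (a - k + 1) / k for s1 / s0. *)
Lemma log_concave_of_ratios (n a k s0 s1 s2 : nat) :
  (0 < k)%N -> (k < a)%N -> (3 * a <= n)%N ->
  (k * n <= k ^ 2 + 2 * a * k + 2 * a + 2)%N ->
  (2 * (a - k.-1) * s0 <= k * s1)%N ->
  (k.+1 * s2 <= (n - 3 * k) * s1)%N ->
  (s0 * s2 <= s1 ^ 2)%N.
Proof.
move=> k_gt0 lt_ka le3 quad up down.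
have c_gt0 : (0 < 2 * (a - k.-1) * k.+1)%N by nia.
rewrite -(leq_pmul2l c_gt0).
have le_c : (k * (n - 3 * k) <= 2 * (a - k.-1) * k.+1)%N by nia.
apply: (@leq_trans (k * s1 * ((n - 3 * k) * s1))).
  have := leq_mul up down; by rewrite mulnACA.
by rewrite mulnACA mulnn leq_mul2r le_c orbT.
Qed.

Lemma quadratic_bound (R : rcfType) (n a k : nat) :
  (2 <= a)%N -> (3 * a <= n)%N -> (0 < k)%N -> (k < a)%N ->
  (3 * a%:R <= n%:R :> R /\
   n%:R <= 2 * a%:R + 2 * Num.sqrt (2 * a%:R + 2) :> R /\
   a%:R ^+ 2 / (4 * (a%:R + 1)) <= 2 :> R)
  \/
  (2 * a%:R + 2 * Num.sqrt (2 * a%:R + 2) < n%:R :> R /\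
   n%:R <= (2 * (a%:R ^+ 2 + 1) + (a%:R - 1) ^+ 2) / (a%:R - 1) :> R /\
   a%:R * (a%:R - 1) / (a%:R + 1) <= 2 :> R) ->
  (k * n <= k ^ 2 + 2 * a * k + 2 * a + 2)%N.
Proof.
move=> a_ge2 n_ge k_gt0 lt_ka.
have a_ge2R : 2 <= a%:R :> R by rewrite (ler_nat _ 2).
case=> [[_ [le_n _]]|[_ [le_n le_a]]].
  have x_ge0 : 0 <= 2 * a%:R + 2 :> R by lra.
  have y_ge0 := sqrtr_ge0 (2 * a%:R + 2 : R).
  have sq := sqr_sqrtr x_ge0.
  set y := Num.sqrt _ in le_n y_ge0 sq.
  rewrite -(ler_nat R) !(natrD, natrM, natrX).
  have k_gt0R : 0 < k%:R :> R by rewrite ltr0n.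
  (* k^2 - 2 k y + y^2 >= 0, with y^2 = 2a + 2 and n - 2a <= 2y *)
  have := sqr_ge0 (k%:R - y).
  nra.
have le_a' : a%:R * (a%:R - 1) <= 2 * (a%:R + 1) :> R.
  by rewrite -ler_pdivrMr //; lra.
(* a^2 - 3a - 2 <= 0 leaves only a = 2 and a = 3. *)
have a_le3 : (a <= 3)%N.
  rewrite leqNgt; apply/negP => lt3.
  have : 4 <= a%:R :> R by rewrite (ler_nat _ 4).
  nra.
have le_n' : n%:R * (a%:R - 1) <= 2 * (a%:R ^+ 2 + 1) + (a%:R - 1) ^+ 2 :> R.
  by rewrite -ler_pdivlMr //; lra.
have {}le_n : (n * (a - 1) <= 2 * (a ^ 2 + 1) + (a - 1) ^ 2)%N.
  rewrite -(ler_nat R) !(natrD, natrM, natrX, natrB) //; lia.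
have [a2|a3] : a = 2%N \/ a = 3%N by lia.
  have k1 : k = 1%N by lia.
  by move: le_n; rewrite a2 k1; lia.
have [kE|kE] : k = 1%N \/ k = 2%N by lia.
  by move: le_n; rewrite a3 kE; lia.
by move: le_n; rewrite a3 kE; lia.
Qed.

Theorem corollary6p2 (R : rcfType) (T : finType) (e : rel T)
    (e_sym : symmetric e) (e_irr : irreflexive e)
    (G_conn : connected_graph e) (G_W2 : in_W e 2)
    (n a : nat) (n_def : n = #|T|) (a_def : a = alpha e)
    (a_ge2 : (2 <= a)%N) (n_ge : (3 * a <= n)%N) :
    (3 * a%:R <= n%:R :> R /\
     n%:R <= 2 * a%:R + 2 * Num.sqrt (2 * a%:R + 2) :> R /\
     a%:R ^+ 2 / (4 * (a%:R + 1)) <= 2 :> R)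
    \/
    (2 * a%:R + 2 * Num.sqrt (2 * a%:R + 2) < n%:R :> R /\
     n%:R <= (2 * (a%:R ^+ 2 + 1) + (a%:R - 1) ^+ 2) / (a%:R - 1) :> R /\
     a%:R * (a%:R - 1) / (a%:R + 1) <= 2 :> R) ->
  log_concave (indep_poly e).
Proof.
move=> cond k; rewrite size_indep_poly -a_def /= => /andP[k_gt0 le_k].
have lt_ka : (k < a)%N by lia.
have quad := quadratic_bound a_ge2 n_ge k_gt0 lt_ka cond.
have ET := in_W2_exchangeable e_irr G_W2.
rewrite /indep_poly !coef_poly -a_def !ifT; try lia.
rewrite -natrM -natrX ler_nat subn1 addn1.
apply: log_concave_of_ratios quad _ _ => //.
  by have := num_independent_up e_sym e_irr k.-1 ET; rewrite prednK // -a_def.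
by rewrite n_def; apply: num_independent_down; rewrite // -a_def -n_def.
Qed.
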